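(* Let $q$ be a prime power and let $k\ge 4$ be an even integer. Then $$A_q(4k, 2k; 2k) \ge q^{2k(k+1)} + a(q,2k,2k,k,k) + q^{k(k/2+2)} + 2q^k + 1.$$
   Context: For a prime power $q$, the subspace distance between subspaces $U,U'$ of $\mathbb{F}_q^n$ is $d(U,U')=\dim(U+U')-\dim(U\cap U')$. $A_q(n,d;k)$ denotes the maximum cardinality of a set of $k$-dimensional subspaces of $\mathbb{F}_q^n$ any two distinct elements of which have subspace distance at least $d$ (a set with at most one element satisfies this vacuously). Write $\left[\begin{smallmatrix} n \\ k \end{smallmatrix}\right]_q=\prod_{i=0}^{k-1}\frac{q^{n-i}-1}{q^{k-i}-1}$. For $1\le d_r\le r\le\min\{m,n\}$ set $$a(q,m,n,d_r,r)=\left[\begin{smallmatrix} \min\{n,m\} \\ r \end{smallmatrix}\right]_q\sum_{s=0}^{r-d_r}(-1)^s q^{\binom{s}{2}}\left[\begin{smallmatrix} r \\ s \end{smallmatrix}\right]_q\left(q^{\max\{n,m\}(r-d_r-s+1)}-1\right),$$ which is the number of rank-$r$ elements of any additive subset of $\mathbb{F}_q^{m\times n}$ of size $q^{\max\{m,n\}(\min\{m,n\}-d_r+1)}$ in which distinct matrices $M,M'$ satisfy $\operatorname{rk}(M-M')\ge d_r$. *)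

(* Defs.v *)
From HB Require Import structures.
From mathcomp Require Import all_boot all_order all_algebra all_field.

Set Implicit Arguments.
Unset Strict Implicit.
Unset Printing Implicit Defensive.

(* For the subType structure on {vspace vT}. *)
Import VectorInternalTheory.
Import GRing.Theory Num.Theory.

HB.instance Definition _ (F : finFieldType) (vT : vectType F) :=
  [Countable of {vspace vT} by <:].
HB.instance Definition _ (F : finFieldType) (vT : vectType F) :=
  [Finite of {vspace vT} by <:].

(* The truncated subtraction is exact, as U :&: U' is a subspace of U + U'. *)
Definition subspace_dist (F : finFieldType) (n : nat)
    (U U' : {vspace 'rV[F]_n}) : nat :=
  (\dim (U + U') - \dim (U :&: U'))%N.

Definition is_subspace_code (F : finFieldType) (n d k : nat)
    (C : {set {vspace 'rV[F]_n}}) : bool :=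
  [forall U in C, \dim U == k] &&
  [forall U in C, forall U' in C, (U != U') ==> (d <= subspace_dist U U')].

(* A_q(n, d; k), where q is the cardinality of F. *)
Definition subspace_code_max (F : finFieldType) (n d k : nat) : nat :=
  \max_(C : {set {vspace 'rV[F]_n}} | is_subspace_code d k C) #|C|.

Local Open Scope ring_scope.

(* The Gaussian binomial [n, k]_q, for k <= n; the differences n - i and k - i are taken in nat. *)
Definition gauss_binom (q n k : nat) : rat :=
  \prod_(i < k) ((q%:R ^+ (n - i) - 1) / (q%:R ^+ (k - i) - 1)).

(* For 1 <= dr <= r <= minn m n: the number of rank-r matrices in an additive
   m x n MRD code over F_q with minimum rank distance dr. *)
Definition mrd_rank_count (q m n dr r : nat) : rat :=
  gauss_binom q (minn n m) r *
  \sum_(s < (r - dr).+1)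
     (-1) ^+ s * q%:R ^+ 'C(s, 2) * gauss_binom q r s *
     (q%:R ^+ (maxn n m * (r - dr - s + 1)) - 1).

(* Main.v *)
Require Import Defs.
From HB Require Import structures.
From mathcomp Require Import all_boot all_order all_algebra all_field zify.

Set Implicit Arguments.
Unset Strict Implicit.
Unset Printing Implicit Defensive.

Import VectorInternalTheory.
Import Order.TTheory GRing.Theory Num.Theory.
Local Open Scope ring_scope.

(** Write the ambient space as the sum of two copies of F^(2k), F being the
field with q elements, and call E1 and E2 the two summands.  A subspace of
dimension 2k is given as the row space of a matrix with 2k rows; two of them
are at distance at least 2k as soon as the stacked matrix has rank at least
3k ([code_max_lower_bound]).  The code is the union of three families.

- The row spaces of (1 | M), for M in a linear MRD code G of square matrices
  of order 2k and minimum rank k.  The size of G is q^(2k(k+1)).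
- The row spaces of (M | 1), for M of rank exactly k in the same G.  Such a
  space meets one of the first family in dimension at most rank M = k.
- The sums U + V with U in E1 and V in E2, both of dimension k.  A space of the
  first family meets E2 trivially, one of the second family meets E1
  trivially; as U + V has dimension 2k and meets E1 and E2 in dimension k each,
  it meets either one in dimension at most k.

Inside the third family the distances of the two components add up.  Let K0,
contained in K1, be MRD codes of square matrices of order k, of minimum ranks k
and k/2.  The pairs U = (1 | M), V = (1 | M + B) with M in K1 and B in K0 are
admissible: if both components change, each contributes k/2, and if only one
changes, the change lies in K0 and contributes k.  They number q^(k(k/2+2)).
The space (0 | 1) is at maximal distance from all the (1 | M), so the q^k pairs
((0 | 1), (1 | B)), the q^k pairs ((1 | B), (0 | 1)) and the pair
((0 | 1), (0 | 1)) can be added.  [linkage_code_bound] and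
[nested_product_code] carry out this construction.

The nested MRD codes are Gabidulin codes ([nested_mrd_codes]): over the
extension of F of degree N, a nonzero linearized polynomial with t coefficients
has at most q^(t-1) roots, hence a kernel of dimension at most t - 1.

The matrices of rank k in G are counted through their row spaces
([mrd_rank_count_le]).  For each subspace X of dimension k, the matrices of G
with rows in X are cut out by 2k * k linear equations, so there are at least
q^(2k) of them; the nonzero ones have rank k, hence row space X.  The number of
subspaces X is the Gaussian binomial coefficient, since there are
prod_(i < k) (q^n - q^i) matrices of size k x n with independent rows. *)

(** * Row spaces as subspaces *)

(** The row space of a matrix, as a subspace of the space of row vectors. *)
Definition row_space (F : fieldType) (m n : nat) (A : 'M[F]_(m, n)) :
    {vspace 'rV[F]_n} :=
  limg (linfun (mulmxr A)).

Lemma memv_row_space (F : fieldType) (m n : nat) (A : 'M[F]_(m, n)) u :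
  (u \in row_space A) = (u <= A)%MS.
Proof.
apply/memv_imgP/submxP => [[v _ ->]|[v ->]]; exists v; rewrite ?lfunE //.
exact: memvf.
Qed.

Lemma dim_row_space (F : fieldType) (m n : nat) (A : 'M[F]_(m, n)) :
  \dim (row_space A) = \rank A.
Proof.
have -> : row_space A = row_space (row_base A).
  by apply/vspaceP => u; rewrite !memv_row_space eq_row_base.
rewrite /row_space limg_dim_eq; first by rewrite dimvf /dim /= mul1n.
apply/eqP; rewrite capfv -subv0; apply/subvP => u.
rewrite memv_ker lfunE memv0 /= -[_ *m _ == 0]subr_eq0 subr0.
by rewrite -(inj_eq (row_free_inj (row_base_free A))) mul0mx.
Qed.

Lemma card_row_space (F : finFieldType) (m n : nat) (A : 'M[F]_(m, n)) :
  #|[set u : 'rV_n | (u <= A)%MS]| = (#|F| ^ \rank A)%N.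
Proof.
rewrite -dim_row_space -card_vspace; apply: eq_card => u.
by rewrite inE memv_row_space.
Qed.

(** * Ranks of block matrices and lower bounds on subspace codes *)

(** The rank of a block matrix through the Schur complement of its upper left
identity block. *)
Lemma rank_schur (F : fieldType) (m n p : nat) (M : 'M[F]_(m, n))
    (A : 'M_(p, m)) (B : 'M_(p, n)) :
  \rank (block_mx 1%:M M A B) = (m + \rank (B - A *m M)%R)%N.
Proof.
have -> : block_mx 1%:M M A B = block_mx 1%:M 0 A 1%:M *m
    block_mx 1%:M 0 0 (B - A *m M) *m block_mx 1%:M M 0 1%:M.
  rewrite !mulmx_block !(mulmx0, mul0mx, mulmx1, mul1mx, addr0, add0r).
  by rewrite addrC subrK.
rewrite mxrankMfree ?row_free_unit; last first.
  by rewrite unitmxE det_ublock !det1 mulr1 unitr1.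
rewrite eqmxMfull ?row_full_unit; last first.
  by rewrite unitmxE det_lblock !det1 mulr1 unitr1.
by rewrite rank_diag_block_mx mxrank1.
Qed.

Lemma rank_col_mxC (F : fieldType) (m n p : nat) (A : 'M[F]_(m, n))
    (B : 'M_(p, n)) :
  \rank (col_mx A B) = \rank (col_mx B A).
Proof. by rewrite -!addsmxE addsmxC. Qed.

Lemma rank_row_mxC (F : fieldType) (m n p : nat) (A : 'M[F]_(m, n))
    (B : 'M_(m, p)) :
  \rank (row_mx A B) = \rank (row_mx B A).
Proof. by rewrite -mxrank_tr tr_row_mx rank_col_mxC -tr_row_mx mxrank_tr. Qed.

Lemma rank_block_mxC (F : fieldType) (m n p r : nat) (A : 'M[F]_(m, n))
    (B : 'M_(m, p)) (C : 'M_(r, n)) (D : 'M_(r, p)) :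
  \rank (block_mx A B C D) = \rank (block_mx B A D C).
Proof. by rewrite !block_mxEh rank_row_mxC. Qed.

Lemma rank_col_diag (F : fieldType) (m n p r : nat)
    (A A' : 'M[F]_(m, n)) (B B' : 'M_(p, r)) :
  \rank (col_mx (block_mx A 0 0 B) (block_mx A' 0 0 B')) =
  (\rank (col_mx A A') + \rank (col_mx B B'))%N.
Proof.
rewrite -rank_diag_block_mx !block_mxEv -[in RHS](@col_mx0 _ m m r).
rewrite -[in RHS](@col_mx0 _ p p n) -!block_mxEh !block_mxEv -!addsmxE.
have cE s (C : 'M[F]_(s, n + r)) t (D : 'M_(t, n + r)) := eqmx_sym (addsmxE C D).
rewrite !(adds_eqmx (cE _ _ _ _) (cE _ _ _ _)) -addsmxA [X in (_ + X)%MS]addsmxA.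
by rewrite [X in (_ + (X + _))%MS]addsmxC -[X in (_ + X)%MS]addsmxA addsmxA.
Qed.

Lemma row_spaceD (F : fieldType) (m p n : nat) (A : 'M[F]_(m, n)) (B : 'M_(p, n)) :
  (row_space A + row_space B)%VS = row_space (col_mx A B).
Proof.
apply/vspaceP => u; rewrite memv_row_space -addsmxE.
apply/memv_addP/sub_addsmxP => [[v vA [w wB ->]]|[[v w] /= ->]].
  move: vA wB; rewrite !memv_row_space => /submxP[v' ->] /submxP[w' ->].
  by exists (v', w').
by exists (v *m A); [|exists (w *m B)]; rewrite ?memv_row_space ?submxMl.
Qed.

(** If dim U = dim V = m and dim (U + V) >= m + e, then the subspace distance
2 dim (U + V) - 2m is at least 2e.  As e > 0, the family is injective. *)
Lemma code_max_lower_bound (F : finFieldType) (T : finType) (m n e : nat)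
    (f : T -> 'M[F]_(m, n)) :
    (0 < e)%N -> (forall i, \rank (f i) = m) ->
    (forall i j, i <> j -> (m + e <= \rank (col_mx (f i) (f j)))%N) ->
  (#|T| <= subspace_code_max F n (e + e) m)%N.
Proof.
move=> e_gt0 rk_f rk_ff; pose g i := row_space (f i).
have dim_g i : \dim (g i) = m by rewrite dim_row_space.
have g_inj : injective g.
  move=> i j gij; apply/eqP; apply: contraTT isT => /eqP/rk_ff.
  rewrite -dim_row_space -row_spaceD -/(g i) gij addvv dim_g.
  by rewrite -[X in (_ <= X)%N]addn0 leq_add2l leqNgt e_gt0.
rewrite -(card_imset _ g_inj).
apply: (@leq_bigmax_cond _ (fun C => is_subspace_code (e + e) m C)
  (fun C => #|C|)).
apply/andP; split; apply/forall_inP => _ /imsetP[i _ ->]; first by rewrite dim_g.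
apply/forall_inP => _ /imsetP[j _ ->]; apply/implyP => ne_g.
have /rk_ff rk_ij : i <> j by move=> ij; rewrite ij eqxx in ne_g.
have := dimv_sum_cap (g i) (g j); rewrite !dim_g /subspace_dist.
rewrite /g row_spaceD dim_row_space in rk_ij *.
move: (\dim _) => d; move: (\rank _) rk_ij => r; lia.
Qed.

(** * Extensions of a finite field of given degree *)

Lemma card_pchar_nat (F : finFieldType) (L : fieldExtType F) :
  [pchar L].-nat #|F| /\ #|F|%:R = 0 :> L.
Proof.
have [p p_pr pcharFp] := finPcharP F.
have pcharLp : p \in [pchar L] by rewrite pchar_lalg.
have [e qE] : exists e, #|F| = (p ^ e)%N.
  by exists (logn p #|F|); apply: card_pprimeChar pcharFp.
split; first by rewrite qE pnatX pnatE ?pcharLp.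
apply/eqP; rewrite -(dvdn_pcharf pcharLp) qE dvdn_exp //.
by rewrite lt0n; apply: contraTneq (finNzRing_gt1 F) => e0; rewrite qE e0.
Qed.

(** The [i]-th power of the Frobenius map of an extension of F. *)
Definition frobenius (F : finFieldType) (L : fieldExtType F) (i : nat) (x : L) :=
  x ^+ (#|F| ^ i).

Lemma frobenius_linear (F : finFieldType) (L : fieldExtType F) (i : nat) :
  linear (@frobenius F L i).
Proof.
move=> c x y; rewrite /frobenius exprDn_pchar; last first.
  by rewrite pnatX (card_pchar_nat L).1.
rewrite exprZn; congr (_ *: _ + _).
by elim: i => [|i IHi]; rewrite ?expn0 ?expr1 // expnS exprM expf_card.
Qed.

HB.instance Definition _ (F : finFieldType) (L : fieldExtType F) (i : nat) :=
  GRing.isLinear.Build F L L *:%R (@frobenius F L i) (@frobenius_linear F L i).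

(** The extension of degree N is the set of roots of X^m - X, m = q^N, in a
splitting field of this polynomial. *)
Lemma fieldExt_of_dim (F : finFieldType) (N : nat) :
  (0 < N)%N -> exists L : fieldExtType F, \dim {:L} = N.
Proof.
move=> N_gt0; set m := (#|F| ^ N)%N.
have m_gt1 : (1 < m)%N by rewrite -[1%N](expn0 #|F|) ltn_exp2l ?finNzRing_gt1.
pose P (R : nzRingType) : {poly R} := 'X^m - 'X.
have szP (R : nzRingType) : size (P R) = m.+1.
  by rewrite size_polyDl size_polyXn // size_polyN size_polyX.
have P_neq0 : P F != 0 by rewrite -size_poly_gt0 szP.
have [/= L [zs Dzs _]] := FinSplittingFieldFor P_neq0.
rewrite rmorphB rmorphXn /= map_polyX -/(P L) in Dzs.
(* The derivative of X^m - X is -1, so its roots are simple. *)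
have uniq_zs : uniq zs.
  rewrite -separable_prod_XsubC -(eqp_separable Dzs) unlock.
  rewrite derivB derivXn derivX -scaler_nat natrX (card_pchar_nat L).2.
  rewrite expr0n eqn0Ngt N_gt0 scale0r sub0r -scaleN1r.
  by rewrite coprimepZr ?coprimep1 // oppr_eq0 oner_eq0.
pose E := fixedSpace (linfun (@frobenius F L N)).
have memE x : (x \in E) = (x ^+ m == x).
  by rewrite (sameP fixedSpaceP eqP) lfunE.
have zsE : zs =i E.
  move=> x; rewrite memE -root_prod_XsubC -(eqp_root Dzs).
  by rewrite /root !hornerE subr_eq0.
have dimE : \dim E = N.
  apply/(expnI (finNzRing_gt1 F)).
  pose finL := FinFieldExtType L.
  transitivity #|[pred x : finL | x \in E]|.
    exact/esym/(@card_vspace F finL (Vector.class L) E).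
  rewrite -(@eq_card finL (mem zs) _ zsE).
  rewrite (card_uniqP _) //; apply: succn_inj.
  by rewrite -(size_prod_XsubC _ id) -(eqp_size Dzs) szP.
have aspE : is_aspace E.
  rewrite /is_aspace has_algid1 ?memE ?expr1n //=.
  by apply/prodvP => x y; rewrite !memE exprMn => /eqP-> /eqP->.
by exists (subvs_of (ASpace aspE)); rewrite dimvf.
Qed.

(** * Gabidulin codes *)

(** The map x |-> \sum_(i < t) a_i x^(q^i) of L, read in the coordinates of L
over F. *)
Definition linearized_fun (F : finFieldType) (L : fieldExtType F) (t : nat)
    (a : {ffun 'I_t -> L}) (u : 'rV[F]_(dim L)) : 'rV[F]_(dim L) :=
  v2r (\sum_i a i * frobenius i (r2v u)).

Lemma linearized_fun_linear (F : finFieldType) (L : fieldExtType F) (t : nat)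
  (a : {ffun 'I_t -> L}) : linear (linearized_fun a).
Proof.
move=> c u v; rewrite /linearized_fun -linearP; congr v2r.
rewrite scaler_sumr -big_split; apply: eq_bigr => i _ /=.
by rewrite !linearP mulrDr scalerAr.
Qed.

HB.instance Definition _ (F : finFieldType) (L : fieldExtType F) (t : nat)
    (a : {ffun 'I_t -> L}) :=
  GRing.isLinear.Build F _ _ *:%R (linearized_fun a) (linearized_fun_linear a).

(** Its matrix, acting on row vectors. *)
Definition linearized_mx (F : finFieldType) (L : fieldExtType F) (t : nat)
    (a : {ffun 'I_t -> L}) : 'M[F]_(dim L) :=
  lin1_mx (linearized_fun a).

Lemma linearized_mx_linear (F : finFieldType) (L : fieldExtType F) (t : nat) :
  linear (@linearized_mx F L t).
Proof.
move=> c a b; apply/matrixP => i j; rewrite !mxE /linearized_fun.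
set u := r2v _.
have -> : \sum_(l < t) (c *: a + b) l * frobenius l u =
    c *: (\sum_(l < t) a l * frobenius l u) + \sum_(l < t) b l * frobenius l u.
  rewrite scaler_sumr -big_split; apply: eq_bigr => l _ /=.
  by rewrite !ffunE mulrDl scalerAl.
by rewrite linearP !mxE.
Qed.

HB.instance Definition _ (F : finFieldType) (L : fieldExtType F) (t : nat) :=
  GRing.isLinear.Build F {ffun 'I_t -> L} 'M[F]_(dim L) *:%R
    (@linearized_mx F L t) (@linearized_mx_linear F L t).

(** The kernel consists of roots of the polynomial \sum_(i < t) a_i X^(q^i),
whose degree is at most q^(t-1). *)
Lemma linearized_mx_rank (F : finFieldType) (L : fieldExtType F) (t : nat)
    (a : {ffun 'I_t -> L}) :
  a != 0 -> (dim L < \rank (linearized_mx a) + t)%N.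
Proof.
move=> a_neq0; set M := linearized_mx a; set q := #|F|.
have q_gt1 : (1 < q)%N by apply: finNzRing_gt1.
have [i0 ai0_neq0] : exists i, a i != 0.
  apply/existsP; apply: contraNT a_neq0; rewrite negb_exists => /forallP a0.
  by apply/eqP/ffunP => i; rewrite ffunE; apply/eqP; rewrite -[_ == _]negbK a0.
pose P : {poly L} := \sum_(i < t) a i *: 'X^(q ^ i).
have P_neq0 : P != 0.
  apply: contraNneq ai0_neq0 => P0; have := coef0 L (q ^ i0); rewrite -P0.
  rewrite coef_sum (bigD1 i0) //= coefZ coefXn eqxx mulr1.
  rewrite big1 ?addr0 => [->//|i ne_i].
  by rewrite coefZ coefXn eqn_exp2l // (inj_eq val_inj) eq_sym (negPf ne_i) mulr0.
have szP : (size P <= (q ^ t.-1).+1)%N.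
  apply: (leq_trans (size_sum _ _ _)); apply/bigmax_leqP => i _.
  apply: (leq_trans (size_scale_leq _ _)); rewrite size_polyXn ltnS.
  by rewrite leq_exp2l // -ltnS prednK ?(leq_ltn_trans (leq0n i)).
pose rs := [seq (r2v u : L) | u <- enum [set u | (u <= kermx M)%MS]].
have root_rs : all (root P) rs.
  apply/allP => _ /mapP[u /[!mem_enum] /[!inE] uM ->].
  move: uM; rewrite sub_kermx mul_rV_lin1 /= => /eqP /(congr1 (@r2v _ L)).
  rewrite v2rK linear0 => Pu; rewrite /root horner_sum -[X in _ == X]Pu.
  by apply/eqP/eq_bigr => i _; rewrite hornerZ hornerXn.
have uniq_rs : uniq rs by rewrite map_inj_uniq ?enum_uniq //; apply: can_inj r2vK.
have := leq_trans (max_poly_roots P_neq0 root_rs uniq_rs) szP.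
rewrite size_map -cardE card_row_space mxrank_ker ltnS leq_exp2l //.
rewrite -ltnS prednK; last by rewrite (leq_ltn_trans (leq0n i0)).
by rewrite -ltn_subLR ?rank_leq_row // addnC.
Qed.

(** The matrices of the linearized polynomials with [t] coefficients. *)
Definition gabidulin (F : finFieldType) (L : fieldExtType F) (t : nat) :
    {vspace 'M[F]_(dim L)} :=
  limg (linfun (@linearized_mx F L t)).

Lemma gabidulinP (F : finFieldType) (L : fieldExtType F) (t : nat) A :
  reflect (exists a : {ffun 'I_t -> L}, A = linearized_mx a)
    (A \in gabidulin L t).
Proof.
apply: (iffP memv_imgP) => [[a _ ->]|[a ->]]; exists a; rewrite ?lfunE //.
exact: memvf.
Qed.

Lemma dim_gabidulin (F : finFieldType) (L : fieldExtType F) (t : nat) :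
  (t <= dim L)%N -> \dim (gabidulin L t) = (dim L * t)%N.
Proof.
move=> le_tL; rewrite /gabidulin limg_dim_eq; last first.
  apply/eqP; rewrite capfv -subv0; apply/subvP => a.
  rewrite memv_ker lfunE memv0 /= => /eqP a0.
  apply: contraT => /linearized_mx_rank.
  by rewrite a0 mxrank0 ltnNge le_tL.
by rewrite dimvf /dim /= card_ord mulnC.
Qed.

Lemma gabidulin_subv (F : finFieldType) (L : fieldExtType F) (s t : nat) :
  (s <= t)%N -> (gabidulin L s <= gabidulin L t)%VS.
Proof.
move=> le_st; apply/subvP => _ /gabidulinP[a ->]; apply/gabidulinP.
(* The coefficients are padded with zeros. *)
pose a' (i : nat) : L := oapp a 0 (insub i).
exists [ffun i : 'I_t => a' i]; apply/matrixP => i j; rewrite !mxE.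
rewrite /linearized_fun; set u := r2v _; congr (v2r _ 0 j).
under [RHS]eq_bigr => l _ do rewrite ffunE.
rewrite (eq_bigr (fun l : 'I_s => a' l * frobenius l u)) => [|l _].
  rewrite (big_ord_widen _ (fun l => a' l * frobenius l u) le_st).
  rewrite [RHS](bigID (fun l : 'I_t => l < s)%N) /=.
  rewrite [X in _ = _ + X]big1 ?addr0 // => l.
  by move=> ge_ls; rewrite /a' insubN ?mul0r.
by rewrite /a' valK.
Qed.

(** For every size N > 0 there is a chain of linear MRD codes: for t <= N the
[t]-th one has dimension N t, and its nonzero elements have rank at least N - t + 1. *)
Lemma nested_mrd_codes (F : finFieldType) (N : nat) : (0 < N)%N ->
  exists G : nat -> {vspace 'M[F]_N},
  [/\ forall t, (t <= N)%N -> \dim (G t) = (N * t)%N,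
      forall t A, A \in G t -> A != 0 -> (N < \rank A + t)%N &
      forall s t, (s <= t)%N -> (G s <= G t)%VS].
Proof.
move=> /fieldExt_of_dim-/(_ F)[L]; rewrite dimvf => <-; exists (gabidulin L).
split; [exact: dim_gabidulin | | exact: gabidulin_subv].
move=> t _ /gabidulinP[a ->] a_neq0; apply: linearized_mx_rank.
by apply: contraNneq a_neq0 => ->; rewrite linear0.
Qed.

(** * Matrices of minimum rank in an MRD code *)

Lemma row_free_col_mx (F : fieldType) (m n : nat) (v : 'rV[F]_n) (A : 'M_(m, n)) :
  row_free (col_mx v A) = row_free A && ~~ (v <= A)%MS.
Proof.
rewrite /row_free -addsmxE.
have [le_r eq_r] := mxrank_leqif_sup (addsmxSr v A).
rewrite addsmx_sub submx_refl andbT in eq_r; rewrite -eq_r.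
have := (mxrank_adds_leqif v A).1; have := rank_leq_row v.
have := rank_leq_row A; lia.
Qed.

Lemma card_row_free (F : finFieldType) (m n : nat) : (m <= n)%N ->
  #|[set A : 'M[F]_(m, n) | row_free A]| =
  (\prod_(i < m) (#|F| ^ n - #|F| ^ i))%N.
Proof.
elim: m => [|m IHm] lt_mn.
  rewrite big_ord0 (eq_card1 (x := 0)) // => A.
  by rewrite !inE flatmx0 -row_leq_rank leq0n eqxx.
rewrite big_ord_recr /= -(IHm (ltnW lt_mn)) -sum_nat_const -sum1_card.
rewrite (reindex (fun vA : 'rV[F]_n * 'M_(m, n) =>
  col_mx vA.1 vA.2)) /=; last first.
  exists (fun B : 'M_(1 + m, n) => (usubmx B, dsubmx B)) => [[v A]|B] _ /=.
    by rewrite col_mxKu col_mxKd.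
  by rewrite vsubmxK.
rewrite (eq_bigl (fun vA : 'rV[F]_n * 'M_(m, n) =>
  row_free vA.2 && ~~ (vA.1 <= vA.2)%MS)); last first.
  by move=> [v A]; rewrite inE row_free_col_mx.
under [RHS]eq_bigl => A do rewrite inE.
rewrite -(pair_big_dep xpredT (fun v A => row_free A && ~~ (v <= A)%MS)
  (fun _ _ => 1%N)) /=.
rewrite (exchange_big_dep (fun A : 'M_(m, n) => row_free A)) /=; last
  by move=> v A _ /andP[].
apply: eq_bigr => A rfA; rewrite rfA sum1dep_card.
have <- : #|'rV[F]_n| = (#|F| ^ n)%N by rewrite card_mx mul1n.
have -> : (#|F| ^ m)%N = #|[set u : 'rV_n | (u <= A)%MS]|.
  by rewrite card_row_space (eqP rfA).
rewrite -(cardC [set u : 'rV_n | (u <= A)%MS]) addKn.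
by apply: eq_card => v; rewrite !inE.
Qed.

(** The condition that the rows of A lie in the row space of X amounts to
n (n - k) linear equations on A. *)
Lemma card_sub_row_free (F : finFieldType) (n k e : nat) (C : {vspace 'M[F]_n})
    (X : 'M_(k, n)) :
  row_free X -> (n * (n - k) + e <= \dim C)%N ->
  (#|F| ^ e <= #|[set A in C | (A <= X)%MS]|)%N.
Proof.
move=> /eqP rkX leC.
pose phi := linfun (mulmxr (col_base (cokermx X)) : 'M[F]_n -> _).
have le_e : (e <= \dim (C :&: lker phi))%N.
  rewrite -(leq_add2l (n * (n - k))) (leq_trans leC) // -(limg_ker_dim phi C) addnC.
  rewrite leq_add2r (leq_trans (dimvS (subvf _))) // dimvf /dim /=.
  by rewrite mxrank_coker rkX.
apply: (leq_trans (leq_pexp2l (ltnW (finNzRing_gt1 F)) le_e)).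
rewrite -card_vspace; apply/subset_leq_card/subsetP => A.
rewrite inE memv_cap memv_ker lfunE /= => /andP[-> /eqP A0].
by rewrite submxE -[cokermx X]mulmx_base mulmxA A0 mul0mx eqxx.
Qed.

(** A subspace of dimension k has at most as many bases as there are invertible
matrices of order k; the subspace is given here as the row space of A. *)
Lemma card_row_free_sup (F : finFieldType) (m n k : nat) (A : 'M[F]_(m, n)) :
  \rank A = k ->
  (#|[set X : 'M_(k, n) | row_free X & (A <= X)%MS]|
     <= #|[set Y : 'M[F]_k | row_free Y]|)%N.
Proof.
move=> rkA; set S := [set X | _ & _].
have [->|[X0]] := set_0Vmem S; first by rewrite cards0.
rewrite inE => /andP[rfX0 sAX0].
(* The row spaces of A and of the members of S coincide, having dimension k. *)
have sub_A X : X \in S -> (X <= A)%MS.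
  rewrite inE => /andP[/eqP rkX sAX].
  by rewrite -(mxrank_leqif_sup sAX).2 rkA rkX.
apply: leq_trans (leq_imset_card (fun Y : 'M_k => Y *m X0) _).
apply/subset_leq_card/subsetP => X SX.
have /submxP[Y XE] := submx_trans (sub_A X SX) sAX0.
apply/imsetP; exists Y => //; move: SX; rewrite !inE XE /row_free.
by rewrite mxrankMfree // => /andP[].
Qed.

(** Double counting of the pairs (X, A), where A has rank k and lies in C, and
X is a basis of the row space of A. *)
Lemma card_min_rank (F : finFieldType) (n k e : nat) (C : {vspace 'M[F]_n}) :
    (forall A, A \in C -> A != 0 -> (k <= \rank A)%N) ->
    (n * (n - k) + e <= \dim C)%N ->
  (#|[set X : 'M[F]_(k, n) | row_free X]| * (#|F| ^ e - 1)
     <= #|[set A in C | \rank A == k]| * #|[set Y : 'M[F]_k | row_free Y]|)%N.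
Proof.
move=> minC leC; rewrite -!sum_nat_const.
apply: (@leq_trans (\sum_(X in [set X : 'M[F]_(k, n) | row_free X])
   \sum_(A in [set A in C | \rank A == k] | (A <= X)%MS) 1)%N).
  apply: leq_sum => X; rewrite inE => rfX.
  rewrite sum1dep_card leq_subLR.
  apply: (leq_trans (card_sub_row_free rfX leC)).
  (* All the matrices found have rank k, except possibly the zero matrix. *)
  rewrite (cardsD1 0) leq_add ?leq_b1 //; apply/subset_leq_card/subsetP => A.
  rewrite !inE => /and3P[A_neq0 CA sAX]; rewrite CA sAX !andbT /=.
  by rewrite eqn_leq minC // andbT (leq_trans (mxrankS sAX)) ?rank_leq_row.
rewrite (exchange_big_dep
  (fun A => A \in [set A in C | \rank A == k])) /=; last by move=> X A _ /andP[].
apply: leq_sum => A CkA; rewrite sum1dep_card.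
have /card_row_free_sup : \rank A = k by move: CkA; rewrite inE => /andP[_ /eqP].
apply: leq_trans; apply/subset_leq_card/subsetP => X.
by rewrite !inE => /and3P[-> _ ->].
Qed.

(** The Gaussian binomial coefficient is the number of k x n matrices with
independent rows divided by the order of the general linear group of degree
k. *)
Lemma gauss_binomE (F : finFieldType) (n k : nat) : (k <= n)%N ->
  gauss_binom #|F| n k * #|[set Y : 'M[F]_k | row_free Y]|%:R =
  #|[set X : 'M[F]_(k, n) | row_free X]|%:R.
Proof.
move=> le_kn; rewrite !card_row_free // !natr_prod -big_split /=.
apply: eq_bigr => i _; set q := #|F|.
have q_gt1 : (1 < q)%N by apply: finNzRing_gt1.
have split_pow m : (i < m)%N ->
    (q ^ m - q ^ i)%N%:R = q%:R ^+ i * (q%:R ^+ (m - i) - 1) :> rat.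
  move=> /ltnW le_im; rewrite natrB ?leq_exp2l // !natrX mulrBr mulr1.
  by rewrite -exprD subnKC.
rewrite !split_pow ?(leq_trans (ltn_ord i)) // mulrCA divfK //.
rewrite subr_eq0 -natrX (eqr_nat _ _ 1) -[1%N](expn0 q) eqn_exp2l //.
by rewrite subn_eq0 -ltnNge.
Qed.

Lemma mrd_rank_count_le (F : finFieldType) (n k : nat) (C : {vspace 'M[F]_n}) :
    (k <= n)%N ->
    (forall A, A \in C -> A != 0 -> (k <= \rank A)%N) ->
    (n * (n - k + 1) <= \dim C)%N ->
  mrd_rank_count #|F| n n k k <= #|[set A in C | \rank A == k]|%:R.
Proof.
move=> le_kn minC; rewrite mulnDr muln1 => /(card_min_rank minC) leC.
have rf_gt0 : (0 < #|[set Y : 'M[F]_k | row_free Y]|)%N.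
  by apply/card_gt0P; exists 1%:M; rewrite inE row_free_unit unitmx1.
rewrite /mrd_rank_count minnn maxnn subnn big_ord1 /= /gauss_binom big_ord0.
rewrite expr0 !mul1r muln1 -/(gauss_binom _ _ _).
rewrite -(ler_pM2r (x := #|[set Y : 'M[F]_k | row_free Y]|%:R)) ?ltr0n //.
have -> : #|F|%:R ^+ n - 1 = (#|F| ^ n - 1)%N%:R :> rat.
  by rewrite natrB ?natrX // expn_gt0 ltnW ?finNzRing_gt1.
by rewrite mulrAC gauss_binomE // -!natrM ler_nat.
Qed.

(** * The subspace code *)

(** The union of the spaces (1 | M), the spaces (M | 1) with rank M = k, and
the direct sums of the row spaces of A i and B i, the latter family being
assumed to have the required distance. *)
Lemma linkage_code_bound (F : finFieldType) (k : nat) (G : {vspace 'M[F]_(k + k)})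
    (T : finType) (A B : T -> 'M[F]_(k, k + k)) :
    (0 < k)%N ->
    (forall M, M \in G -> M != 0 -> (k <= \rank M)%N) ->
    (forall i, \rank (A i) = k) -> (forall i, \rank (B i) = k) ->
    (forall i j, i <> j ->
       (k + k + k <= \rank (col_mx (A i) (A j)) + \rank (col_mx (B i) (B j)))%N) ->
  (#|G| + #|[set M in G | \rank M == k]| + #|T|
     <= subspace_code_max F ((k + k) + (k + k)) (k + k) (k + k))%N.
Proof.
move=> k_gt0 minG rkA rkB rkAB.
pose f (x : {M | M \in G} + {M | M \in [set M in G | \rank M == k]} + T) :
    'M[F]_(k + k, (k + k) + (k + k)) :=
  match x with
  | inl (inl M) => row_mx 1%:M (val M)
  | inl (inr M) => row_mx (val M) 1%:M
  | inr i => block_mx (A i) 0 0 (B i)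
  end.
have rk_same (M M' : 'M[F]_(k + k)) : M \in G -> M' \in G -> M <> M' ->
    (k + k + k <= \rank (block_mx 1%:M M 1%:M M'))%N.
  move=> GM GM' ne_MM'; rewrite rank_schur leq_add2l mul1mx minG ?rpredB //.
  by rewrite subr_eq0; apply/eqP => eqM; case: ne_MM'.
have rk_opp (M M' : 'M[F]_(k + k)) : \rank M' = k ->
    (k + k + k <= \rank (block_mx 1%:M M M' 1%:M))%N.
  move=> rkM'; rewrite rank_schur leq_add2l.
  have := mxrank_add (1%:M - M' *m M) (M' *m M); rewrite subrK mxrank1.
  move=> /leq_trans le_rk; rewrite -(leq_add2r k); apply: le_rk.
  by rewrite leq_add2l (leq_trans (mxrankM_maxl M' M)) ?rkM'.
have rk_prod (M : 'M[F]_(k + k)) i :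
    (k + k + k <= \rank (col_mx (row_mx 1%:M M) (block_mx (A i) 0 0 (B i))))%N.
  rewrite block_mxEh -block_mxEv rank_schur leq_add2l -[X in (X <= _)%N](rkB i).
  rewrite mul_col_mx mul0mx opp_col_mx add_col_mx oppr0 addr0.
  by rewrite -addsmxE mxrankS ?addsmxSr.
have rk_prod' (M : 'M[F]_(k + k)) i :
    (k + k + k <= \rank (col_mx (row_mx M 1%:M) (block_mx (A i) 0 0 (B i))))%N.
  rewrite block_mxEh -block_mxEv rank_block_mxC rank_schur leq_add2l.
  rewrite -[X in (X <= _)%N](rkA i).
  rewrite mul_col_mx mul0mx opp_col_mx add_col_mx oppr0 addr0.
  by rewrite -addsmxE mxrankS ?addsmxSl.
have -> : #|G| = #|{: {M | M \in G}}| by rewrite card_sig.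
have -> : #|[set M in G | \rank M == k]| =
    #|{: {M | M \in [set M in G | \rank M == k]}}| by rewrite card_sig.
rewrite -!card_sum; apply: (code_max_lower_bound (f := f)) => //.
  case=> [[M|M]|i] /=.
  - apply/eqP; rewrite -/(row_free _); apply/row_freeP.
    by exists (col_mx 1%:M 0); rewrite mul_row_col mulmx1 mulmx0 addr0.
  - apply/eqP; rewrite -/(row_free _); apply/row_freeP.
    by exists (col_mx 0 1%:M); rewrite mul_row_col mulmx1 mulmx0 add0r.
  - by rewrite rank_diag_block_mx rkA rkB.
have mem2 (M : {M | M \in [set M in G | \rank M == k]}) :
    val M \in G /\ \rank (val M) = k.
  by have := valP M; rewrite inE => /andP[? /eqP].
case=> [[M|M]|i] [[M'|M']|j] ne /=.
- rewrite -block_mxEv; apply: rk_same (valP M) (valP M') _.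
  by move=> /val_inj eqM; apply: ne; rewrite eqM.
- by rewrite -block_mxEv rk_opp ?(mem2 _).2.
- exact: rk_prod.
- by rewrite rank_col_mxC -block_mxEv rk_opp ?(mem2 _).2.
- rewrite -block_mxEv rank_block_mxC; apply: rk_same (mem2 M).1 (mem2 M').1 _.
  by move=> /val_inj eqM; apply: ne; rewrite eqM.
- exact: rk_prod'.
- by rewrite rank_col_mxC rk_prod.
- by rewrite rank_col_mxC rk_prod'.
- by rewrite rank_col_diag rkAB // => ij; apply: ne; rewrite ij.
Qed.

(** A k x 2k matrix of rank k: (1 | M) for [Some M], and (0 | 1), the point at
infinity, for [None]. *)
Definition chart (F : fieldType) (k : nat) (o : option 'M[F]_k) : 'M_(k, k + k) :=
  if o is Some M then row_mx 1%:M M else row_mx 0 1%:M.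

(** The codimension of the intersection of two such row spaces in either of
them, that is, half of their subspace distance; see [rank_chart2]. *)
Definition chart_gap (F : fieldType) (k : nat) (o o' : option 'M[F]_k) : nat :=
  match o, o' with
  | Some M, Some M' => \rank (M' - M)
  | None, None => 0
  | _, _ => k
  end.

Lemma rank_chart (F : fieldType) (k : nat) (o : option 'M[F]_k) :
  \rank (chart o) = k.
Proof.
apply/eqP; rewrite -/(row_free _); apply/row_freeP; case: o => [M|] /=.
  by exists (col_mx 1%:M 0); rewrite mul_row_col mulmx1 mulmx0 addr0.
by exists (col_mx 0 1%:M); rewrite mul_row_col mulmx1 mulmx0 add0r.
Qed.

Lemma rank_chart2 (F : fieldType) (k : nat) (o o' : option 'M[F]_k) :
  \rank (col_mx (chart o) (chart o')) = (k + chart_gap o o')%N.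
Proof.
case: o o' => [M|] [M'|] /=.
- by rewrite -block_mxEv rank_schur mul1mx.
- by rewrite -block_mxEv rank_schur mul0mx subr0 mxrank1.
- by rewrite rank_col_mxC -block_mxEv rank_schur mul0mx subr0 mxrank1.
- rewrite -addsmxE (addsmx_idPl (submx_refl _)) addn0.
  exact: (rank_chart (@None 'M[F]_k)).
Qed.

(** The pairs (M, M + B) with M in G1 and B in G0, the pairs made of infinity
and of an element of G0, in both orders, and the pair of points at infinity. *)
Lemma nested_product_code (F : finFieldType) (k h : nat) (G0 G1 : {vspace 'M[F]_k}) :
    (k <= h + h)%N -> (G0 <= G1)%VS ->
    (forall M, M \in G0 -> M != 0 -> (k <= \rank M)%N) ->
    (forall M, M \in G1 -> M != 0 -> (h <= \rank M)%N) ->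
  exists (T : finType) (a b : T -> option 'M[F]_k),
    #|T| = (#|G1| * #|G0| + 2 * #|G0| + 1)%N /\
    (forall i j, i <> j -> (k <= chart_gap (a i) (a j) + chart_gap (b i) (b j))%N).
Proof.
move=> le_kh sG01 minG0 minG1.
pose T0 := {M | M \in G0}; pose T1 := {M | M \in G1}.
exists (T1 * T0 + T0 + T0 + unit)%type.
exists (fun x => match x with
  | inl (inl (inl p)) => Some (val p.1)
  | inl (inr M) => Some (val M)
  | _ => None
  end).
exists (fun x => match x with
  | inl (inl (inl p)) => Some (val p.1 + val p.2)
  | inl (inl (inr M)) => Some (val M)
  | _ => None
  end).
split; first by rewrite !card_sum card_prod !card_sig card_unit mul2n -addnn !addnA.
(* If the two indices belong to different families, then in one of the
components exactly one of the two charts is at infinity, and the gap is k. *)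
case=> [[[[M B]|M]|M]|[]] [[[[M' B']|M']|M']|[]] ne //=;
  rewrite ?leq_addl ?leq_addr ?addn0 ?add0n //.
- have /= GB := valP B; have /= GB' := valP B'.
  have /= GM := valP M; have /= GM' := valP M'.
  (* The two components change by D and by D + E, with E in G0. *)
  rewrite opprD addrACA; set D := val M' - val M; set E := val B' - val B.
  have GD : D \in G1 by rewrite rpredB.
  have GE : E \in G0 by rewrite rpredB.
  have [D0|D_neq0] := eqVneq D 0.
    rewrite D0 add0r mxrank0 minG0 // subr_eq0; apply/eqP => /val_inj eqB.
    by move/eqP: D0; rewrite subr_eq0 => /eqP/val_inj eqM; case: ne; rewrite eqM eqB.
  have [DE0|DE_neq0] := eqVneq (D + E) 0.
    rewrite DE0 mxrank0 addn0 minG0 //.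
    by move/eqP: DE0; rewrite addr_eq0 => /eqP->; rewrite rpredN.
  by rewrite (leq_trans le_kh) // leq_add // minG1 // rpredD // (subvP sG01).
- have /= GM := valP M; have /= GM' := valP M'.
  rewrite minG0 ?rpredB // subr_eq0; apply/eqP => /val_inj eqM.
  by case: ne; rewrite eqM.
- have /= GM := valP M; have /= GM' := valP M'.
  rewrite minG0 ?rpredB // subr_eq0; apply/eqP => /val_inj eqM.
  by case: ne; rewrite eqM.
Qed.

Theorem mainTheorem4 (q : nat) (F : finFieldType) (hF : #|F| = q)
    (k : nat) (hk : (4 <= k)%N) (hk_even : ~~ odd k) :
  (subspace_code_max F (4 * k) (2 * k) (2 * k))%:R >=
  q%:R ^+ (2 * k * (k + 1)) + mrd_rank_count q (2 * k) (2 * k) k k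
  + q%:R ^+ (k * (k./2 + 2)) + 2 * q%:R ^+ k + 1 :> rat.
Proof.
have k_gt0 : (0 < k)%N by apply: leq_trans hk.
have k2 : (2 * k = k + k)%N by rewrite mul2n addnn.
have k4 : (4 * k = (k + k) + (k + k))%N.
  by rewrite -[4%N]/(2 * 2)%N -mulnA k2 mulnDr k2.
have hE : (k = k./2 + k./2)%N by rewrite addnn even_halfK.
rewrite k2 k4 -hF; move: {hk_even}k./2 hE => h hE.
have [|H [dimH minH _]] := @nested_mrd_codes F (k + k).
  by rewrite addn_gt0 k_gt0.
have [K [dimK minK subK]] := @nested_mrd_codes F k k_gt0.
have dimG : \dim (H k.+1) = ((k + k) * (k + 1))%N.
  by rewrite addn1 dimH // -addn1 leq_add2l.
have minG M : M \in H k.+1 -> M != 0 -> (k <= \rank M)%N.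
  by move=> HM M_neq0; have := minH _ _ HM M_neq0; rewrite addnS ltnS leq_add2r.
have minK0 M : M \in K 1%N -> M != 0 -> (k <= \rank M)%N.
  by move=> KM M_neq0; have := minK _ _ KM M_neq0; rewrite addn1 ltnS.
have minK1 M : M \in K h.+1 -> M != 0 -> (h <= \rank M)%N.
  move=> KM M_neq0; have := minK _ _ KM M_neq0.
  by rewrite addnS ltnS {1}hE leq_add2r.
have h_lt_k : (h < k)%N by lia.
have le_khh : (k <= h + h)%N by rewrite -hE.
have [T [a [b [cardT gap]]]] :=
  nested_product_code le_khh (subK 1%N h.+1 isT) minK0 minK1.
have := @linkage_code_bound F k (H k.+1) T
  (fun i => chart (a i)) (fun i => chart (b i)) k_gt0 minG.
move=> /(_ (fun i => rank_chart (a i)) (fun i => rank_chart (b i))) => bound.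
have {bound} : (#|H k.+1| + #|[set M in H k.+1 | \rank M == k]| + #|T|
     <= subspace_code_max F ((k + k) + (k + k)) (k + k) (k + k))%N.
  by apply: bound => i j /gap; rewrite !rank_chart2 addnACA leq_add2l.
rewrite -(ler_nat rat); apply: le_trans.
rewrite cardT !card_vspace dimG !dimK //.
rewrite !natrD natrM !natrX -!addrA lerD2l.
have le_k2 : (k <= k + k)%N by rewrite leq_addr.
have := mrd_rank_count_le le_k2 minG; rewrite dimG addnK => /(_ (leqnn _)) le_a.
apply: lerD => //.
by rewrite -exprD -mulnDr muln1 addn1 addn2 mulr_natl mulr2n add0r !addrA.
Qed.
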